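(* Let $\kappa$ be an infinite cardinal and let $G$ be a regular $2$-semitopological group which, as a topological space, is $\kappa$-Lindelöf and a $\kappa$-$\Sigma$-space. Then $G$ is a $\kappa$-cellular space.
   Context: A semitopological group is a group with a topology making multiplication separately continuous. A semitopological group $G$ is a $2$-semitopological group if for every $g\in G$ with $e\notin\overline{\{g\}}$ there is a neighborhood $W$ of the neutral element $e$ with $g\notin W^{2}=WW$. Regular spaces are understood, as in Engelking's book, to be $T_1$. The Lindelöf degree $l(X)$ of a space $X$ is $\omega\cdot\min\{\lambda:$ every open cover of $X$ has a subcover of cardinality at most $\lambda\}$; $X$ is $\kappa$-Lindelöf if $l(X)=\kappa$. A space $X$ is $\kappa$-countably compact if each open cover of $X$ of size $\leq\kappa$ has a finite subcover. A space $X$ is a $\kappa$-$\Sigma$-space if there exist a family $\mathscr{P}=\bigcup_{\alpha<\kappa}\mathscr{P}_\alpha$ of subsets of $X$ with each $\mathscr{P}_\alpha$ locally finite, and a cover $\mathscr{C}$ of $X$ by closed $\kappa$-countably compact sets, such that whenever $C\in\mathscr{C}$ and $C\subset U$ with $U$ open, then $C\subset P\subset U$ for some $P\in\mathscr{P}$. A space $X$ is $\kappa$-cellular if for each family $\mu$ of $G_\delta$-sets of $X$ there exists a subfamily $\lambda\subset\mu$ such that $|\lambda|\leq\kappa$ and $\overline{\bigcup\mu}=\overline{\bigcup\lambda}$. *)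

(* Defs.v *)
From HB Require Import structures.
From mathcomp Require Import all_boot.
From mathcomp Require Import all_classical topology borel_hierarchy.

Set Implicit Arguments.
Unset Strict Implicit.
Unset Printing Implicit Defensive.

Local Open Scope classical_set_scope.
Local Open Scope card_scope.

HB.mixin Record isSemitopologicalGroup G of Topological G & Group G := {
  mulg_continuousl : forall a : G, continuous (fun x : G => (a * x)%g);
  mulg_continuousr : forall a : G, continuous (fun x : G => (x * a)%g)
}.

#[short(type="semitopologicalGroupType")]
HB.structure Definition SemitopologicalGroup :=
  {G of Topological G & Group G & isSemitopologicalGroup G}.

Definition two_semitopological (G : semitopologicalGroupType) : Prop :=
  forall g : G, ~ closure [set g] (1%g : G) ->
    exists2 W : set G, nbhs (1%g : G) W &
      ~ [set (x * y)%g | x in W & y in W] g.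

(* Regular in Engelking's sense: the T1 axiom is included. *)
Definition regular_T1 (X : topologicalType) : Prop :=
  accessible_space X /\ regular_space X.

(* A cardinal kappa is represented by a type K, with kappa = |K|. *)

Definition open_cover (X : topologicalType) (A : set X) (U : set (set X)) :
    Prop :=
  (forall O, U O -> open O) /\ A `<=` \bigcup_(O in U) O.

Definition has_subcovers (X : topologicalType) (L : Type) : Prop :=
  forall U : set (set X), open_cover [set: X] U ->
    exists V : set (set X),
      [/\ V `<=` U, [set: X] `<=` \bigcup_(O in V) O & V #<= [set: L]].

(* l(X) = |K|: L realizes the minimum, and nat * L is the product with omega. *)
Definition kLindelof (K : Type) (X : topologicalType) : Prop :=
  exists L : Type,
    [/\ has_subcovers X L,
        (forall M : Type, has_subcovers X M -> [set: L] #<= [set: M]) &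
        [set: K] #= [set: nat * L]].

(* For a subset C with its subspace topology, expressed through covers of C by
   open sets of the ambient space, as in [cover_compact]. *)
Definition kcountably_compact (K : Type) (X : topologicalType) (C : set X) :
    Prop :=
  forall U : set (set X), open_cover C U -> U #<= [set: K] ->
    exists V : set (set X),
      [/\ V `<=` U, finite_set V & C `<=` \bigcup_(O in V) O].

Definition locally_finite (X : topologicalType) (F : set (set X)) : Prop :=
  forall x : X, exists2 N : set X, nbhs x N &
    finite_set [set A | F A /\ A `&` N !=set0].

Definition kSigma_space (K : Type) (X : topologicalType) : Prop :=
  exists (P : K -> set (set X)) (C : set (set X)),
    [/\ forall k, locally_finite (P k),
        \bigcup_(A in C) A = [set: X],
        forall A, C A -> closed A /\ kcountably_compact K A &
        forall A O, C A -> open O -> A `<=` O ->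
          exists B, [/\ (\bigcup_k P k) B, A `<=` B & B `<=` O]].

Definition kcellular (K : Type) (X : topologicalType) : Prop :=
  forall mu : set (set X), (forall A, mu A -> Gdelta A) ->
    exists la : set (set X),
      [/\ la `<=` mu, la #<= [set: K] &
          closure (\bigcup_(A in mu) A) = closure (\bigcup_(A in la) A)].

(* Main.v *)
(* Pick for each x in Y = \bigcup mu some A_x in mu through x. Closing off yields
   a set S of size at most kappa that meets every nonempty finite intersection
   of sets from a family determined by S itself and by the network of the
   Sigma-structure; the family { A_x | x in S :&: Y } is the desired one. If z in
   Y were outside the closure of its union, an ultrafilter on S :&: Y following z
   in these sets would, by compactness of the members of the cover around z and
   z^-1, make x converge to some y and x^-1 to the inverse of y, because the
   graph of inversion is closed in a 2-semitopological group. Separate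
   continuity and regularity give y^-1 z in x^-1 A_x for every x in S :&: Y, so
   x y^-1 z in A_x; but x y^-1 z tends to z, a contradiction. *)
Require Import Defs.
From mathcomp Require Import all_boot.
From mathcomp Require Import all_classical topology borel_hierarchy.

Set Implicit Arguments.
Unset Strict Implicit.
Unset Printing Implicit Defensive.
Local Open Scope classical_set_scope.
Local Open Scope card_scope.

(** * Comparison of cardinals and Hessenberg's theorem *)

(** [R] need not be single-valued: choice picks the values, and the second condition makes the
    chosen map injective. Cardinal bounds can thus be proved without handling subtypes. *)
Lemma card_le_relP T U (A : set T) (B : set U) :
  A #<= B <-> exists R : T -> U -> Prop,
    (forall x, A x -> exists2 y, B y & R x y) /\
    (forall x x' y, A x -> A x' -> R x y -> R x' y -> x = x').
Proof.
split=> [/card_leP/unsquash f|[R [Rtot Rinj]]].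
  exists (fun x y => exists2 a : A, val a = x & val (f a) = y); split.
    move=> x Ax; exists (val (f (SigSub (mem_set Ax)))); first exact: set_valP.
    by exists (SigSub (mem_set Ax)).
  move=> x x' y Ax Ax' [a <- <-] [a' <-] /val_inj/inj -> //.
  - by rewrite inE.
  - by rewrite inE.
have /choice[f fP] : forall a : A, exists b : B, R (val a) (val b).
  move=> a; have [y By Ry] := Rtot _ (set_valP a).
  by exists (SigSub (mem_set By)).
apply/card_leP/injfunPex; exists f => // a a' _ _ faa'; apply: val_inj.
apply: (Rinj _ _ (val (f a))) (set_valP a) (set_valP a') (fP a) _.
by rewrite faa'.
Qed.

(** By Zorn's lemma there is a maximal graph of a partial injection. If it missed a point on each
    side, that pair could be added. *)
Lemma card_le_total T U (A : set T) (B : set U) : A #<= B \/ B #<= A.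
Proof.
pose P (R : set (T * U)) := [/\ forall p, R p -> A p.1 /\ B p.2,
  forall p q, R p -> R q -> p.1 = q.1 -> p.2 = q.2 &
  forall p q, R p -> R q -> p.2 = q.2 -> p.1 = q.1].
have [F FP Ftot|R [[RAB Rfun Rinj] Rmax]] := @Zorn_bigcup _ P.
  have common p q : (\bigcup_(X in F) X) p -> (\bigcup_(X in F) X) q ->
      exists2 X, F X & X p /\ X q.
    move=> [X FX Xp] [Y FY Yq]; have [XY|YX] := Ftot _ _ FX FY.
    - by exists Y => //; split=> //; apply: XY.
    - by exists X => //; split=> //; apply: YX.
  split=> [p [X /FP[XAB _ _]]|p q /common/[apply] -[X /FP[_ Xf _] []]|
           p q /common/[apply] -[X /FP[_ _ Xi] []]].
  - exact: XAB.
  - exact: Xf.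
  - exact: Xi.
have [Rdom|/existsNP[a /not_implyP[Aa Ra]]] :=
    pselect (forall x, A x -> exists y, R (x, y)).
  left; apply/card_le_relP; exists (fun x y => R (x, y)); split.
    by move=> x /Rdom[y Rxy]; exists y => //; have [] := RAB _ Rxy.
  by move=> x x' y _ _ Rxy Rx'y; apply: (Rinj (x, y) (x', y)).
have [Rcod|/existsNP[b /not_implyP[Bb Rb]]] :=
    pselect (forall y, B y -> exists x, R (x, y)).
  right; apply/card_le_relP; exists (fun y x => R (x, y)); split.
    by move=> y /Rcod[x Rxy]; exists x => //; have [] := RAB _ Rxy.
  by move=> y y' x _ _ Rxy Rxy'; apply: (Rfun (x, y) (x, y')).
exfalso; apply: (Rmax (R `|` [set (a, b)])).
  split=> [p Rp|]; first by left.
  by move=> /(_ (a, b) (or_intror erefl)) Rab; apply: Ra; exists b.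
split.
- by move=> p [/RAB//|->].
- move=> [x y] [x' y'] [Rp|[-> ->]] [Rq|[-> ->]] //=.
  + exact: (Rfun _ _ Rp Rq).
  + by move=> xa; case: Ra; exists y; rewrite -xa.
  + by move=> xa; case: Ra; exists y'; rewrite xa.
- move=> [x y] [x' y'] [Rp|[-> ->]] [Rq|[-> ->]] //=.
  + exact: (Rinj _ _ Rp Rq).
  + by move=> yb; case: Rb; exists x; rewrite -yb.
  + by move=> yb; case: Rb; exists x'; rewrite yb.
Qed.

Lemma card_leX T U T' U' (A : set T) (B : set U) (A' : set T') (B' : set U') :
  A #<= A' -> B #<= B' -> A `*` B #<= A' `*` B'.
Proof.
move=> /card_le_relP[R [Rt Ri]] /card_le_relP[Q [Qt Qi]].
apply/card_le_relP; exists (fun p q => R p.1 q.1 /\ Q p.2 q.2); split.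
  move=> [x y] [/= /Rt[x' ? ?] /Qt[y' ? ?]].
  by exists (x', y').
move=> [x y] [x' y'] [u v] [/= ? ?] [/= ? ?] [? ?] [? ?]; congr pair.
  exact: (Ri x x' u).
exact: (Qi y y' v).
Qed.

(** Tagging by a boolean embeds the union into [D * bool], hence into [D * D]. *)
Lemma card_leU_idem T U (A B : set T) (D : set U) : infinite_set D ->
  D `*` D #<= D -> A #<= D -> B #<= D -> A `|` B #<= D.
Proof.
move=> /infiniteP infD DD /card_le_relP[R [Rt Ri]] /card_le_relP[Q [Qt Qi]].
have boolD : [set: bool] #<= D by apply: card_le_trans infD; exact: countableP.
apply: card_le_trans DD; apply: card_le_trans (card_leX (card_lexx D) boolD).
apply/card_le_relP.
exists (fun x p => if p.2 then A x /\ R x p.1 else B x /\ Q x p.1); split.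
  move=> x [Ax|Bx].
    by have [y ? ?] := Rt _ Ax; exists (y, true).
  by have [y ? ?] := Qt _ Bx; exists (y, false).
move=> x x' [y []] _ _ /= [? ?] [? ?]; first exact: (Ri x x' y).
exact: (Qi x x' y).
Qed.

(* Hessenberg's theorem: in a maximal partial injection from D * D to D, the
   complement of D is dominated by D, for otherwise D could be enlarged. *)
Lemma card_le_square K : infinite_set [set: K] -> [set: K * K] #<= [set: K].
Proof.
move=> infK.
(* The set [D G] is read off the diagonal of [G], so Zorn's lemma applies to relations alone, with
   no separate component for the domain. *)
pose D (G : set (K * K * K)) := [set a | exists c, G (a, a, c)].
pose P (G : set (K * K * K)) := [/\
  forall p c, G (p, c) -> [/\ D G p.1, D G p.2 & D G c],
  forall p q c, G (p, c) -> G (q, c) -> p = q &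
  forall a b, D G a -> D G b -> exists c, G (a, b, c)].
have [F FP Ftot|G [[Gdom Ginj Gtot] Gmax]] := @Zorn_bigcup _ P.
  have DS X Y : X `<=` Y -> D X `<=` D Y by move=> XY a [c /XY]; exists c.
  have DU X : F X -> D X `<=` D (\bigcup_(X in F) X).
    by move=> FX; apply: DS => p Xp; exists X.
  split.
  - by move=> p c [X FX /(let: And3 h _ _ := FP _ FX in h _ _)[? ? ?]];
      split; apply: DU FX _ _.
  - move=> p q c [X FX Xp] [Y FY Yq]; have [XY|YX] := Ftot _ _ FX FY.
    + by have [_ h _] := FP _ FY; apply: h Yq; apply: XY.
    + by have [_ h _] := FP _ FX; apply: h Xp _; apply: YX.
  - move=> a b [c [X FX Xa]] [d [Y FY Yb]]; have [XY|YX] := Ftot _ _ FX FY.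
    + have [_ _ h] := FP _ FY; have [||e] := h a b; [|by exists d|].
        by exists c; apply: XY.
      by exists e, Y.
    + have [_ _ h] := FP _ FX; have [||e] := h a b; [by exists c| |].
        by exists d; apply: YX.
      by exists e, X.
have DD : D G `*` D G #<= D G.
  apply/card_le_relP; exists (fun p c => G (p, c)); split.
    move=> [a b] [/= Da Db]; have [c Gc] := Gtot _ _ Da Db.
    by exists c => //; have [] := Gdom _ _ Gc.
  by move=> p q c _ _; apply: Ginj.
have [DC|CD] := card_le_total (~` D G) (D G).
  have infD : infinite_set (D G).
    move=> finD; apply: infK; rewrite -(setUv (D G)) finite_setU; split=> //.
    exact: card_le_finite DC finD.
  have KD : [set: K] #<= D G.
    by rewrite -(setUv (D G)); apply: card_leU_idem.
  rewrite -setXTT; apply: card_le_trans (card_leX KD KD) _.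
  exact: card_le_trans DD (card_leT _).
exfalso.
(* [B] is countably infinite if [D G] is finite, and a copy of [D G] otherwise. *)
have [B [BC [b0 Bb0] DBB]] : exists B, [/\ B `<=` ~` D G, B !=set0 &
    (D G `|` B) `*` (D G `|` B) #<= B].
  have [finD|infD] := pselect (finite_set (D G)).
    have : [set: nat] #<= ~` D G.
      apply/infiniteP => finC; apply: infK.
      by rewrite -(setUv (D G)) finite_setU.
    move=> /card_subP[B BN BC]; exists B; split=> //.
      apply: infinite_setN0; apply/infiniteP.
      by move: BN => /card_eqPle[].
    have cU : D G `|` B #<= [set: nat].
      apply: (card_leU_idem infinite_nat).
      - exact: countableP.
      - exact: finite_set_countable.
      - by move: BN => /card_eqPle[].
    apply: card_le_trans (card_leX cU cU) _.
    apply: (@card_le_trans _ _ _ [set: nat]); first exact: countableP.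
    by move: BN => /card_eqPle[].
  move: CD => /card_subP[B /card_eqPle[BD DB] BC]; exists B; split=> //.
    by apply: infinite_setN0; apply/infiniteP/(card_le_trans _ DB)/infiniteP.
  have cU : D G `|` B #<= D G by apply: card_leU_idem.
  by apply: card_le_trans (card_leX cU cU) _; apply: card_le_trans DD DB.
move: DBB => /card_le_relP[R [Rt Ri]].
(* The new pairs take values in [B], which is disjoint from [D G], so they cannot collide with the
   old ones. *)
pose G' := G `|` [set pc | [/\ (D G `|` B) pc.1.1, (D G `|` B) pc.1.2,
  ~ (D G pc.1.1 /\ D G pc.1.2), B pc.2 & R pc.1 pc.2]].
have DG' : D G' = D G `|` B.
  apply/seteqP; split=> a.
    by move=> [c [Gc|[]//]]; left; exists c.
  move=> [[c Gc]|Ba]; first by exists c; left.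
  have [|c ? ?] := Rt (a, a); first by split; right.
  by exists c; right; split=> //=; [right|right|move=> [/(BC _ Ba)]].
apply: (Gmax G').
  split=> [p Gp|G'G]; first by left.
  have [|c ? ?] := Rt (b0, b0); first by split; right.
  have /G'G/Gdom[/(BC _ Bb0)//] : G' (b0, b0, c).
  by right; split=> //=; [right|right|move=> [/(BC _ Bb0)]].
split.
- move=> p c; rewrite DG' => -[/Gdom[? ? ?]|[? ? _ ? _]]; first by split; left.
  by split=> //; right.
- move=> p q c [Gp|[/= p1 p2 _ Bc Rp]] [Gq|[/= q1 q2 _ Bc' Rq]].
  + exact: Ginj Gp Gq.
  + by have [_ _ /(BC _ Bc')] := Gdom _ _ Gp.
  + by have [_ _ /(BC _ Bc)] := Gdom _ _ Gq.
  + by apply: Ri Rp Rq.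
- move=> a b; rewrite DG' => Ua Ub.
  have [[Da Db]|nD] := pselect (D G a /\ D G b).
    by have [c Gc] := Gtot _ _ Da Db; exists c; left.
  by have [|c ? ?] := Rt (a, b); [split|exists c; right; split].
Qed.

(** * Families of size at most an infinite cardinal, and closing off *)

Section InfiniteCardinal.
Variables (K : Type) (infK : infinite_set [set: K]).

Lemma card_le_bigcup I T (D : set I) (F : I -> set T) : D #<= [set: K] ->
  (forall i, D i -> F i #<= [set: K]) -> \bigcup_(i in D) F i #<= [set: K].
Proof.
move=> /card_le_relP[R [Rt Ri]] FK.
have /choice[Q QP] : forall i, exists Q : T -> K -> Prop, D i ->
    (forall x, F i x -> exists2 y, [set: K] y & Q x y) /\
    (forall x x' y, F i x -> F i x' -> Q x y -> Q x' y -> x = x').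
  move=> i; have [/FK/card_le_relP[Q QP]|nDi] := pselect (D i).
    by exists Q.
  by exists (fun _ _ => True).
apply: card_le_trans (card_le_square infK); apply/card_le_relP.
exists (fun x p => exists i, [/\ D i, F i x, R i p.1 & Q i x p.2]); split.
  move=> x [i Di Fix]; have [k _ Rik] := Rt _ Di.
  have [l _ Qil] := (QP _ Di).1 _ Fix.
  by exists (k, l) => //; exists i.
move=> x x' [k l] _ _ [i [Di Fx Rk Ql]] [i' [Di' Fx' Rk' Ql']].
have ii' := Ri _ _ _ Di Di' Rk Rk'; rewrite -{}ii' in Fx' Ql' *.
exact: (QP _ Di).2 _ _ _ Fx Fx' Ql Ql'.
Qed.

Lemma card_leU T (A B : set T) :
  A #<= [set: K] -> B #<= [set: K] -> A `|` B #<= [set: K].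
Proof.
by move=> AK BK; apply: card_leU_idem => //; rewrite setXTT card_le_square.
Qed.

Lemma card_le_countable T (A : set T) : countable A -> A #<= [set: K].
Proof. by move=> cA; apply: card_le_trans cA _; apply/infiniteP. Qed.

Lemma card_le_seq (T : eqType) (A : set T) : A #<= [set: K] ->
  [set s : seq T | forall x, x \in s -> A x] #<= [set: K].
Proof.
move=> AK.
rewrite (_ : [set s | _] = \bigcup_n
    [set s : seq T | size s = n /\ forall x, x \in s -> A x]); last first.
  by apply/seteqP; split=> s; [exists (size s)|move=> [n _ []]].
apply: card_le_bigcup => [|n _]; first exact/card_le_countable/countableP.
elim: n => [|n IHn].
  apply: (card_le_trans (B := [set [::] : seq T])).
    by apply: subset_card_le => s [/size0nil ->].
  exact/card_le_countable/finite_set_countable/finite_set1.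
have := card_le_trans (card_leX AK IHn) _.
rewrite setXTT => /(_ _ _ (card_le_square infK)).
apply: card_le_trans.
apply: (card_le_trans _ (card_image_le (fun p => p.1 :: p.2) _)).
apply: subset_card_le => -[[]//|x s [[ss] sA]]; exists (x, s) => //.
by split=> /=; [|split=> // y ys]; apply: sA; rewrite inE ?eqxx ?ys ?orbT.
Qed.

(* A closing-off argument in place of elementary submodels: [S] is built to meet
   every nonempty finite intersection of sets of [gen q r], [q] and [r] in [S]. *)
Lemma closing_off T (t0 : T) (gen : T -> T -> set (set T)) :
  (forall q r, gen q r #<= [set: K]) ->
  exists2 S : set T, S #<= [set: K] &
    forall z, exists F : set_system T, [/\ UltraFilter F, F S &
      forall q r B, S q -> S r -> gen q r B -> B z -> F B].
Proof.
move=> genK.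
have /choice[h hP] (s : seq (set T)) : exists x,
    (exists y, forall B, B \in s -> B y) -> forall B, B \in s -> B x.
  have [[x sx]|ns] := pselect (exists y, forall B, B \in s -> B y).
    by exists x.
  by exists t0 => /ns.
pose W (A : set T) := \bigcup_(q in A) \bigcup_(r in A) gen q r.
have WS A A' : A `<=` A' -> W A `<=` W A'.
  move=> AA' B [q Aq [r Ar gB]].
  by exists q; [exact: AA'|exists r => //; exact: AA'].
(* One stage adds a common point, if there is one, for each finite list of sets with parameters in
   [A]. *)
pose Phi (A : set T) := A `|` h @` [set s | forall B, B \in s -> W A B].
pose S := \bigcup_n iter n Phi set0.
have iterS m n : (m <= n)%N -> iter m Phi set0 `<=` iter n Phi set0.
  by move=> /subnK <-; elim: (n - m)%N => //= k IHk x /IHk; left.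
exists S.
  apply: card_le_bigcup => [|n _]; first exact/card_le_countable/countableP.
  elim: n => [|n IHn] /=; first exact: card_ge0.
  apply: card_leU => //; apply: card_le_trans (card_image_le _ _) _.
  by apply: card_le_seq; do 2 apply: card_le_bigcup => // ? ?.
have Smeets (s : seq (set T)) : (forall B, B \in s -> W S B) ->
    (exists y, forall B, B \in s -> B y) -> S (h s).
  move=> sW s0.
  (* A finite list involves finitely many parameters, which all appear by some stage [n]; stage
     [n.+1] then contains the chosen point. *)
  suff [n sn] : exists n, forall B, B \in s -> W (iter n Phi set0) B.
    by exists n.+1 => //; right; exists s.
  elim: s sW {s0} => [|B s IHs] sW; first by exists 0%N.
  have [|n sn] := IHs; first by move=> C Cs; apply: sW; rewrite inE Cs orbT.
  have [|q [i _ Sq] [r [j _ Sr] gB]] := sW B; first by rewrite inE eqxx.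
  exists (maxn n (maxn i j)) => C; rewrite inE => /orP[/eqP ->|/sn].
    exists q; first by apply: iterS Sq; rewrite !leq_max leqnn orbT.
    by exists r => //; apply: iterS Sr; rewrite !leq_max leqnn !orbT.
  by apply: WS; apply: iterS; rewrite leq_maxl.
move=> z.
pose D := [set s : seq (set T) | forall B, B \in s -> W S B /\ B z].
pose meet (s : seq (set T)) := S `&` [set x | forall B, B \in s -> B x].
have Dmeet : ProperFilter (filter_from D meet).
  apply: filter_from_proper; first apply: filter_from_filter.
  - by exists [::].
  - move=> s t Ds Dt; exists (s ++ t).
      by move=> B; rewrite mem_cat => /orP[/Ds|/Dt].
    by move=> x [Sx stx]; do !split=> //; move=> B Bs; apply: stx;
      rewrite mem_cat Bs ?orbT.
  - move=> s Ds; have zs : exists y, forall B, B \in s -> B y.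
      by exists z => B /Ds[].
    by exists (h s); split; [apply: Smeets => // B /Ds[]|exact: hP].
have [F [UF DF]] := ultraFilterLemma Dmeet; exists F; split=> //.
  by apply: DF; exists [::] => // x [].
move=> q r B Sq Sr gB Bz; apply: DF; exists [:: B].
  by move=> C; rewrite inE => /eqP ->; split=> //; exists q => //; exists r.
by move=> x [_]; apply; rewrite inE.
Qed.

End InfiniteCardinal.

(** * Covers, convergence and translations *)

Lemma has_subcovers_kLindelof K (X : topologicalType) :
  kLindelof K X -> has_subcovers X K.
Proof.
move=> [L [subL _ /card_eqPle[_ LK]]] U /subL[V [VU XV VL]].
exists V; split=> //; apply: card_le_trans VL (card_le_trans _ LK).
apply/card_le_relP; exists (fun l p => p.2 = l); split.
  by move=> l _; exists (0, l).
by move=> l l' p _ _ -> ->.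
Qed.

(** At most [K] open sets, each meeting finitely many members of [F], cover the space, and every
    nonempty member meets one of them. *)
Lemma locally_finite_card_le K (X : topologicalType) (F : set (set X)) :
  infinite_set [set: K] -> has_subcovers X K -> locally_finite F ->
  F #<= [set: K].
Proof.
move=> infK subK Ffin.
pose U := [set N : set X | open N /\
  finite_set [set A | F A /\ A `&` N !=set0]].
have [|V [VU XV VK]] := subK U.
  split=> [N []//|x _]; have [N Nx FN] := Ffin x.
  exists N^°; last exact: Nx.
  split; first exact: open_interior.
  apply: sub_finite_set FN => A [FA [y [Ay /interior_subset Ny]]].
  by split=> //; exists y.
apply: (card_le_trans (B := [set set0] `|`
    \bigcup_(N in V) [set A | F A /\ A `&` N !=set0])).
  apply: subset_card_le => A FA.
  have [->|/set0P[x Ax]] := eqVneq A set0; first by left.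
  by have [N VN Nx] := XV x I; right; exists N => //; split=> //; exists x.
apply: card_leU => //.
  exact/card_le_countable/finite_set_countable/finite_set1.
apply: card_le_bigcup => // N /VU[_ ?].
exact/card_le_countable/finite_set_countable.
Qed.

(** Without a limit in [C], each point of [C] has an open neighborhood whose preimage is not in [F].
    The covering property leaves at most [K] of these, and then [kcountably_compact] finitely many.
    Their union contains [C], so its preimage is in [F], which is absurd for an ultrafilter. *)
Lemma kcountably_compact_ultra_cvg K (X : topologicalType) T (C : set X)
    (F : set_system T) (f : T -> X) :
  has_subcovers X K -> closed C -> kcountably_compact K C -> UltraFilter F ->
  (forall O, open O -> C `<=` O -> F (f @^-1` O)) ->
  exists2 y, C y & f @ F --> y.
Proof.
move=> subK clC kC UF FO; apply: contrapT => ncvg.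
pose U := [set O : set X | open O /\ ~ F (f @^-1` O)].
have CU : C `<=` \bigcup_(O in U) O.
  move=> y Cy; apply: contrapT => nUy; apply: ncvg; exists y => // N.
  rewrite nbhsE => -[O [oO Oy] ON]; apply: contrapT => nFN; apply: nUy.
  exists O => //; split=> // FfO; apply: nFN.
  by apply: filterS FfO => t; exact: ON.
have [|V [VU XV VK]] := subK (U `|` [set ~` C]).
  split=> [O [[]//|->]|x _]; first exact: closed_openC.
  have [Cx|nCx] := pselect (C x); last by exists (~` C) => //; right.
  by have [O UO Ox] := CU _ Cx; exists O => //; left.
have [| |D [DV finD CD]] := kC (V `&` U).
- split=> [O [_ []]//|x Cx]; have [O VO Ox] := XV x I.
  by exists O => //; split=> //; have [//|OC] := VU _ VO; rewrite OC in Ox.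
- by apply: card_le_trans VK; apply: subset_card_le => O [].
have DU : D `<=` U by move=> O /DV[].
have oD : open (\bigcup_(O in D) O) by apply: bigcup_open => O /DU[].
have FnD : F (\bigcap_(O in D) (f @^-1` (~` O))).
  have [E DE] := (finite_fsetP (A := D)).1 finD; rewrite DE.
  apply: filter_bigI => O OE; have [_ nFO] : U O by apply: DU; rewrite DE.
  by have [] := in_ultra_setVsetC (f @^-1` O) UF.
have [t [[O DO Ot] nDt]] := filter_ex (filterI (FO _ oD CD) FnD).
exact: nDt Ot.
Qed.

(* [two_semitopological] says that the graph of the inversion is closed. *)
Lemma cvg_invg_unique (G : semitopologicalGroupType) (F : set_system G)
    {FF : ProperFilter F} (y y' : G) :
  accessible_space G -> two_semitopological G ->
  F --> y -> (fun x => x^-1)%g @ F --> y' -> y' = (y^-1)%g.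
Proof.
move=> T1 G2 Fy Fy'; apply: contrapT => ne.
have [|W W1 nW] := G2 (y^-1 * y'^-1)%g.
  rewrite -(closure_id _).1; last exact: accessible_closed_set1.
  by move=> /= e; apply: ne; rewrite -[LHS]mul1g e mulgVK.
have Fl : F [set x | W (y^-1 * x)%g].
  by apply: Fy; apply: (mulg_continuousl (y^-1)%g y); rewrite mulVg.
have Fr : F [set x | W (x^-1 * y'^-1)%g].
  apply: (Fy' [set v | W (v * y'^-1)%g]).
  by apply: (mulg_continuousr (y'^-1)%g y'); rewrite mulgV.
have [x [/= Wl Wr]] := filter_ex (filterI Fl Fr); apply: nW.
exists (y^-1 * x)%g => //; exists (x^-1 * y'^-1)%g => //.
by rewrite -mulgA mulVKg.
Qed.

(** Each open set in the intersection, translated to the identity, contains the closure of a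
    neighborhood by regularity. Closures are used because their complements are open and so can be
    tested along a limit. *)
Lemma regular_Gdelta_translate (G : semitopologicalGroupType) (A : set G)
    (x : G) : regular_space G -> Gdelta A -> A x ->
  exists V : nat -> set G, forall n, nbhs (1%g : G) (V n) /\
    forall g, (forall n, closure (V n) g) -> A (x * g)%g.
Proof.
move=> regG [O oO AO] Ax.
have /choice[V VP] n : exists V, nbhs (1%g : G) V /\
    closure V `<=` [set g | O n (x * g)%g].
  have [|V V1 VO] := regG (1%g : G) [set g | O n (x * g)%g].
    apply: (mulg_continuousl x); rewrite mulg1; apply: open_nbhs_nbhs.
    by split; [exact: oO|move: Ax; rewrite AO; apply].
  by exists V.
exists V => n; split; first exact: (VP n).1.
by move=> g Vg; rewrite AO => i _; apply: (VP i).2.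
Qed.

(** * The choice of the subfamily and its density *)

Theorem theorem4p15 (K : Type) (G : semitopologicalGroupType) :
  infinite_set [set: K]%classic ->
  regular_T1 G ->
  two_semitopological G ->
  kLindelof K G ->
  kSigma_space K G ->
  kcellular K G.
Proof.
move=> infK [T1 regG] G2 /has_subcovers_kLindelof subK.
move=> [P [CC [Pfin Ccov CCK Pnet]]] mu muG.
pose Y := \bigcup_(A in mu) A.
have /choice[AV AVP] (x : G) : exists AV : set G * (nat -> set G), Y x ->
    [/\ mu AV.1, AV.1 x, forall n, nbhs (1%g : G) (AV.2 n) &
      forall g, (forall n, closure (AV.2 n) g) -> AV.1 (x * g)%g].
  have [[A muA Ax]|nYx] := pselect (Y x); last by exists (setT, fun=> setT).
  have [V VP] := regular_Gdelta_translate regG (muG _ muA) Ax.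
  by exists (A, V) => _; split=> // [n|]; [have [] := VP n|have [] := VP 0].
pose A x := (AV x).1; pose V x := (AV x).2.
pose PP := \bigcup_k P k.
have PPK : PP #<= [set: K].
  by apply: card_le_bigcup => // k _; exact: locally_finite_card_le.
(* The sets [sep] will witness that a translate of [z] avoids a closure; the sets [box] control a
   point and its inverse at once, so that both converge. *)
pose sep (q r : G) n := [set w | ~ closure (V r n) (q^-1 * w)%g].
pose box (B B' : set G) := Y `&` [set w | B w /\ B' (w^-1)%g].
pose gen q r := (range (sep q r)) `|` ((fun p => box p.1 p.2) @` (PP `*` PP)).
have genK q r : gen q r #<= [set: K].
  apply: card_leU => //; apply: card_le_trans (card_image_le _ _) _.
    exact/card_le_countable/countableP.
  apply: card_le_trans (card_leX PPK PPK) _.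
  by rewrite setXTT; exact: card_le_square.
have [S SK SF] := closing_off infK (1%g : G) genK.
exists (A @` (S `&` Y)); split.
- by move=> _ [x [_ /AVP[]] ? ? ? ? <-].
- apply: card_le_trans (card_image_le _ _) (card_le_trans _ SK).
  by apply: subset_card_le => x [].
rewrite -/Y; set la := \bigcup_(B in A @` _) B.
apply/seteqP; split; last first.
  by apply: closureS => x [B [q [_ /AVP[muB _ _ _]] <-] Bx]; exists (A q).
rewrite (closure_id (closure la)).1; last exact: closed_closure.
apply: closureS => z Yz; apply: contrapT => nlaz.
have [F [UF FS Fgen]] := SF z.
(* The boxes belong to [gen q r] for all [q] and [r], so any [q0] in [S] gives access to them. *)
have [q0 Sq0] := filter_ex FS.
have Cof w : exists2 C, CC C & C w by have : [set: G] w by []; rewrite -Ccov.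
have [C CCC Cz] := Cof z; have [C' CCC' Cz'] := Cof (z^-1)%g.
have Fbox B B' : PP B -> PP B' -> C `<=` B -> C' `<=` B' -> F (box B B').
  move=> PB PB' CB CB'; apply: (Fgen q0 q0) => //.
    by right; exists (B, B').
  by split=> //; split; [exact: CB|exact: CB'].
(* [B0] and [B0'] fill the side of a box that is left unconstrained. *)
have [B0 [PB0 CB0 _]] := Pnet _ _ CCC openT (@subsetT _ _).
have [B0' [PB0' CB0' _]] := Pnet _ _ CCC' openT (@subsetT _ _).
have [y _ Fy] : exists2 y, C y & id @ F --> y.
  have [clC kC] := CCK _ CCC.
  apply: (kcountably_compact_ultra_cvg subK clC kC).
  move=> O oO CO; have [B [PB CB BO]] := Pnet _ _ CCC oO CO.
  by apply: filterS (Fbox _ _ PB PB0' CB CB0') => w [_ [/BO]].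
have [y' _ Fy'] : exists2 y, C' y & (fun x => x^-1)%g @ F --> y.
  have [clC kC] := CCK _ CCC'.
  apply: (kcountably_compact_ultra_cvg subK clC kC).
  move=> O oO CO; have [B [PB CB' BO]] := Pnet _ _ CCC' oO CO.
  by apply: filterS (Fbox _ _ PB0 PB CB0 CB') => w [_ [_ /BO]].
move: (Fy'); rewrite (cvg_invg_unique T1 G2 Fy Fy') => {y' Fy'}Fy'.
have FY : F Y by apply: filterS (Fbox _ _ PB0 PB0' CB0 CB0') => w [].
(* If [y^-1 * z] avoided [closure (V x n)], some [q] in [S] close to [y] would have [q^-1 * z]
   outside this closure and [q^-1 * y] inside the interior of [V x n]. As [q] is in [S], the first
   fact passes from [z] to [F]-many [w]; the second does so because [F] converges to [y]. The two
   are incompatible. *)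
have Az x : S x -> Y x -> A x (x * (y^-1 * z))%g.
  move=> Sx /AVP[_ _ V1 VA]; apply: VA => n; apply: contrapT => nV.
  have Fsep : F [set q | sep q x n z].
    apply: (Fy' [set v | ~ closure (V x n) (v * z)%g]).
    apply: (mulg_continuousr z (y^-1)%g (~` closure (V x n))).
    apply: open_nbhs_nbhs; split=> //.
    exact/closed_openC/closed_closure.
  have FV : F [set q | (V x n)^° (q^-1 * y)%g].
    apply: (Fy' [set v | (V x n)^° (v * y)%g]).
    apply: (mulg_continuousr y (y^-1)%g); rewrite mulVg.
    exact/nbhs_interior/V1.
  have [q [Sq [/= sqz Vqy]]] := filter_ex (filterI FS (filterI Fsep FV)).
  have Fs : F (sep q x n) by apply: (Fgen q x) => //; left; exists n.
  have FVq : F [set w | V x n (q^-1 * w)%g].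
    by exact: (Fy _ (mulg_continuousl (q^-1)%g y _ Vqy)).
  have [w [sw Vw]] := filter_ex (filterI Fs FVq).
  exact/sw/subset_closure/Vw.
have Fz : F [set x | ~ closure la (x * (y^-1 * z))%g].
  apply: (Fy _ (mulg_continuousr (y^-1 * z)%g y (~` closure la) _)).
  rewrite mulVKg; apply: open_nbhs_nbhs; split=> //.
  exact/closed_openC/closed_closure.
have [x [[Sx Yx] nx]] := filter_ex (filterI (filterI FS FY) Fz).
apply: nx; apply: subset_closure; exists (A x); last exact: Az.
by exists x.
Qed.
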